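(* Let $P$ be a tree poset of height $h$ and let $x\in P$ be such that every element of $P$ is at distance at most $2$ from $x$ in the undirected Hasse diagram of $P$. Then for every $\varepsilon>0$ there exists $\delta>0$ such that for every sufficiently large $n\in\mathbb N$ the following holds: every family $\mathcal F\subseteq 2^{[n]}$ with $|\mathcal F|\ge (h-1+\varepsilon)\binom{n}{\lfloor n/2\rfloor}$ contains a copy of the blow-up $P(x,\delta n)$.
   Context: Posets are finite collections of finite sets ordered by inclusion. A poset homomorphism $\phi:P\to Q$ is a map with $A\subseteq B\Rightarrow \phi(A)\subseteq\phi(B)$; $Q$ contains a copy of $P$ if there is an injective poset homomorphism $P\to Q$. The Hasse diagram of $P$ is the directed graph on $P$ with an edge $A\to B$ when $A\subsetneq B$ and no $C\in P$ has $A\subsetneq C\subsetneq B$; the undirected Hasse diagram forgets orientations. A tree poset is a poset whose undirected Hasse diagram is a tree. The height of $P$ is the number of elements of a longest chain in $P$. For a tree poset $P$, $x\in P$ and an integer $d\ge2$, the $d$-blow-up $P(x,d)$ rooted at $x$ is the tree poset whose Hasse diagram is obtained as follows: each $u\in P$ at distance $\rho$ from $x$ in the undirected Hasse diagram is replaced by $d^{\rho}$ elements $u^1,\dots,u^{d^\rho}$; for each edge $uv$ of the Hasse diagram with $v$ at distance $\rho-1$ from $x$ (and $u$ at distance $\rho$), the $u^i$ are partitioned into $d^{\rho-1}$ disjoint sets $U^1,\dots,U^{d^{\rho-1}}$ of size $d$ and $v^j$ is joined to every element of $U^j$, with the same orientation as the edge $uv$. The parameter $\delta n$ is rounded down to an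 integer. *)

(* Defs.v *)
From HB Require Import structures.
From mathcomp Require Import all_boot all_order all_algebra.
From mathcomp Require Import reals.
Set Implicit Arguments. Unset Strict Implicit. Unset Printing Implicit Defensive.
Import Order.TTheory GRing.Theory Num.Theory.

Section Hasse.
Variables (disp : Order.disp_t) (T : finPOrderType disp).
Local Open Scope order_scope.

Definition covers (a b : T) : bool :=
  (a < b) && [forall c : T, ~~ ((a < c) && (c < b))].

Definition hasse_adj (a b : T) : bool := covers a b || covers b a.

Definition tree_poset : Prop :=
  (forall u v : T, connect hasse_adj u v) /\
  (forall s : seq T, uniq s -> (2 < size s)%N -> ~~ cycle hasse_adj s).

Fixpoint within (x : T) (k : nat) : {set T} :=
  match k with
  | 0 => [set x]
  | k'.+1 => within x k' :|: [set v | [exists u in within x k', hasse_adj u v]]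
  end.

(* distance from x (the least k with u within distance k; for connected
   diagrams this is < #|T|) *)
Definition hasse_dist (x u : T) : nat :=
  find (fun k => u \in within x k) (iota 0 #|T|).

Definition is_chain (C : {set T}) : bool :=
  [forall a in C, forall b in C, (a <= b) || (b <= a)].

Definition height : nat := \max_(C : {set T} | is_chain C) #|C|.

(* d-blow-up rooted at x: u is replaced by d^(dist u) copies u^i, i < d^(dist u).
   For a Hasse edge uv with dist u = dist v + 1, the copy u^i is joined to
   v^(i %/ d), i.e. the d^(dist u) copies are partitioned into d^(dist v) blocks
   U^j = {u^i | i %/ d = j} of size d, v^j joined to all of U^j. *)
Definition blowup_type (x : T) (d : nat) : finType :=
  {u : T & 'I_(d ^ hasse_dist x u)}.

Definition bu_link (x : T) (d : nat) (a b : blowup_type x d) : bool :=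
  (hasse_dist x (tag a) == (hasse_dist x (tag b)).+1) &&
  (tagged a %/ d == tagged b :> nat).

Definition bu_edge (x : T) (d : nat) (a b : blowup_type x d) : bool :=
  covers (tag a) (tag b) && (bu_link a b || bu_link b a).

Definition blowup_le (x : T) (d : nat) : rel (blowup_type x d) :=
  connect (@bu_edge x d).

End Hasse.

Definition contains_copy (n : nat) (F : {set {set 'I_n}}) (B : finType)
  (leB : rel B) : Prop :=
  exists f : B -> {set 'I_n},
    [/\ injective f, (forall b, f b \in F) &
        (forall a b, leB a b -> f a \subset f b)].

Arguments blowup_le {disp T} x d.
Arguments contains_copy {n} F {B} leB.

(* Main.v *)
(** A uniformly random full chain of subsets meets F in at least h - 1 + eps/2
    members on average, once F is restricted to the middle layers.  Cut the trace
    of F on each full chain into its windows of h consecutive members, and choose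
    a set L of such marked chains maximizing |L| minus gamma times the number of
    full chains through A, summed over all pairs (A, i) with A the i-th member of
    some marked chain in L.  Then L is nonempty, and whenever A occurs as an i-th
    member, it does so on a proportion at least gamma of the full chains through
    A.  The families G_i of i-th members are therefore robust: for A in G_i and
    j <> i, a random full chain through A meets G_j (above A if i < j, below A
    otherwise) with probability at least gamma.

    Given A, a comparable set B of the middle layers lies on a random chain
    through A with probability O(1/n), and O(1/n^2) if |A| and |B| differ by at
    least 2.  So a set from G_j comparable to A can be found outside any forbidden
    set Q, as long as Q has o(n^2) members and o(n) members adjacent to A in the
    hypercube.  Now send x to G_(rank x), choose greedily the delta n copies of
    each neighbour of x, then the copies at distance 2.  A copy attached to y
    avoids all hypercube neighbours of the other vertices y' at distance 1: at
    most 2 of them per y' are also neighbours of y, so this costs little, and it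
    keeps the neighbourhood of y free of copies attached to other vertices. *)

Require Import Defs.
From HB Require Import structures.
From mathcomp Require Import all_boot all_order all_fingroup all_algebra.
From mathcomp Require Import reals.
From mathcomp Require Import zify ring lra.
Set Implicit Arguments. Unset Strict Implicit. Unset Printing Implicit Defensive.
Import Order.TTheory GRing.Theory Num.Theory.

Lemma bin_leS n k : k.*2.+1 <= n -> 'C(n, k) <= 'C(n, k.+1).
Proof.
move=> hk; have E := mul_bin_left n k.
have h : k.+1 <= n - k by lia.
by rewrite -(leq_pmul2l (ltn0Sn k)) E leq_mul2r h orbT.
Qed.

Lemma bin_unimodal n k j : k <= j -> j + k <= n -> 'C(n, k) <= 'C(n, j).
Proof.
wlog hj : j / j.*2 <= n.
  move=> H kj jkn; case: (leqP j.*2 n) => hj; first exact: H.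
  rewrite -(@bin_sub n j); last by lia.
  by apply: H; lia.
move=> kj _; rewrite -(subnKC kj) in hj *.
elim: (j - k) hj => [|i IH] hi; first by rewrite addn0.
by apply: leq_trans (IH _) _; [lia | rewrite addnS bin_leS //; lia].
Qed.

Lemma bin_leS2 n k : 3 * k + 2 <= n -> 2 * 'C(n, k) <= 'C(n, k.+1).
Proof.
move=> hk; have E := mul_bin_left n k.
have h : 2 * k.+1 <= n - k by lia.
by rewrite -(leq_pmul2l (ltn0Sn k)) E mulnA leq_mul2r [k.+1 * 2]mulnC h orbT.
Qed.

Lemma sum_bin_tail n m : 3 * m <= n.+1 -> \sum_(k < m) 'C(n, k) <= 'C(n, m).
Proof.
elim: m => [|m IH] hm; first by rewrite big_ord0.
rewrite big_ord_recr /=; apply: leq_trans (bin_leS2 _); last by lia.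
by rewrite mul2n -addnn leq_add2r IH //; lia.
Qed.

Lemma bin_expn n m j : 3 * (m + j) <= n.+1 -> 2 ^ j * 'C(n, m) <= 'C(n, m + j).
Proof.
elim: j => [|j IH] hj; first by rewrite addn0 mul1n.
rewrite addnS; apply: leq_trans (bin_leS2 _); last by lia.
by rewrite expnS -mulnA leq_mul2l IH //; lia.
Qed.

Lemma card_small_sets (T : finType) m :
  #|[set A : {set T} | #|A| < m]| = \sum_(k < m) 'C(#|T|, k).
Proof.
elim: m => [|m IH].
  by rewrite big_ord0; apply: eq_card0 => A; rewrite inE.
rewrite big_ord_recr /= -IH -(card_draws T) -cardsUI.
rewrite [X in _ = _ + X](_ : _ = 0); last first.
  by apply: eq_card0 => A; rewrite !inE; case: ltngtP.
by rewrite addn0; apply: eq_card => A; rewrite !inE ltnS leq_eqVlt orbC.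
Qed.

Lemma card_large_sets (T : finType) m :
  #|[set A : {set T} | #|T| < #|A| + m]| = #|[set A : {set T} | #|A| < m]|.
Proof.
rewrite -[RHS](card_imset _ (inv_inj (@setCK T))); apply: eq_card => A.
rewrite inE; apply/idP/imsetP => [hA|[B hB ->]].
  by exists (~: A); rewrite ?setCK // inE; have := cardsC A; lia.
by move: hB; rewrite inE; have := cardsC B; lia.
Qed.

Definition middle n (A : {set 'I_n}) := (n <= 4 * #|A|) && (4 * #|A| <= 3 * n).

Lemma card_not_middle n j : 12 * j.+2 <= n ->
  2 ^ j * #|[set A : {set 'I_n} | ~~ middle A]| <= 2 * 'C(n, n./2).
Proof.
move=> hn; set m := (n %/ 4).+1.
have hm : #|[set A : {set 'I_n} | #|A| < m]| <= 'C(n, m).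
  by rewrite card_small_sets card_ord sum_bin_tail // /m; lia.
have hbin : 2 ^ j * 'C(n, m) <= 'C(n, n./2).
  apply: leq_trans (bin_expn _) _; first by rewrite /m; lia.
  by apply: bin_unimodal; rewrite /m; lia.
have sub : [set A : {set 'I_n} | ~~ middle A] \subset
    [set A : {set 'I_n} | #|A| < m] :|: [set A : {set 'I_n} | #|'I_n| < #|A| + m].
  by apply/subsetP => A; rewrite !inE card_ord /middle /m; lia.
have := subset_leq_card sub; rewrite cardsU card_large_sets => hc.
have {}hc : #|[set A : {set 'I_n} | ~~ middle A]| <= 2 * 'C(n, m) by lia.
apply: leq_trans (leq_mul (leqnn _) hc) _.
by rewrite mulnCA leq_mul2l.
Qed.

Definition flag n (s : 'S_n) (k : nat) : {set 'I_n} := s @: [set i : 'I_n | i < k].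

Definition through n (A : {set 'I_n}) : {set 'S_n} :=
  [set s | flag s #|A| == A].

Lemma in_through n (A : {set 'I_n}) s : (s \in through A) = (flag s #|A| == A).
Proof. by rewrite inE. Qed.

Lemma card_flag n (s : 'S_n) k : k <= n -> #|flag s k| = k.
Proof.
move=> kn; rewrite card_imset; last exact: perm_inj.
rewrite -sum1_card (eq_bigl (fun i : 'I_n => i < k)) => [|i]; last by rewrite inE.
by rewrite -(big_ord_widen n (fun=> 1)) // sum1_card card_ord.
Qed.

Lemma flagS n (s : 'S_n) k l : k <= l -> flag s k \subset flag s l.
Proof.
by move=> kl; apply/imsetS/subsetP => i; rewrite !inE => /leq_trans; apply.
Qed.

Lemma flag_proper n (s : 'S_n) k l :
  l <= n -> k < l -> flag s k \proper flag s l.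
Proof.
move=> ln kl; rewrite properEcard flagS ?(ltnW kl) //= !card_flag //.
exact: leq_trans (ltnW kl) ln.
Qed.

Lemma set_perm_trans (T : finType) (A B A' B' : {set T}) :
    A \subset B -> A' \subset B' -> #|A| = #|A'| -> #|B| = #|B'| ->
  exists p : {perm T}, p @: A = A' /\ p @: B = B'.
Proof.
move=> AB AB' cA cB.
pose t (A B : {set T}) := enum A ++ (enum (B :\: A) ++ enum (~: B)).
have ut (C D : {set T}) : C \subset D -> uniq (t C D).
  move=> CD; rewrite /t !cat_uniq !enum_uniq /= andbT; apply/andP; split.
    apply/hasPn => z; rewrite mem_cat !mem_enum !inE.
    by case/orP => [/andP[]//|]; apply: contra => /(subsetP CD).
  by apply/hasPn => z; rewrite !mem_enum !inE => /negPf ->; rewrite andbF.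
have mt (C D : {set T}) z : z \in t C D.
  by rewrite !mem_cat !mem_enum !inE; case: (z \in C); case: (z \in D).
have szA : size (enum A) = size (enum A') by rewrite -!cardE.
have szD : size (enum (B :\: A)) = size (enum (B' :\: A')).
  by rewrite -!cardE !cardsDS // cA cB.
have szt : size (t A' B') = size (t A B).
  rewrite /t !size_cat szA szD -!cardE.
  by have := cardsC B; have := cardsC B'; lia.
pose f z := nth z (t A' B') (index z (t A B)).
have fE z z0 : f z = nth z0 (t A' B') (index z (t A B)).
  by apply: set_nth_default; rewrite szt index_mem mt.
have finj : injective f.
  move=> y z; rewrite (fE y y) (fE z y) => /eqP.
  rewrite nth_uniq ?ut ?szt ?index_mem ?mt // => /eqP E.
  by rewrite -(nth_index y (mt A B y)) E nth_index.
have fA z : (z \in A) -> (f z \in A').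
  move=> zA; have : index z (t A B) < size (enum A').
    by rewrite /t index_cat mem_enum zA -szA index_mem mem_enum.
  by move=> h; rewrite -mem_enum /f nth_cat h mem_nth.
have fB z : (z \in B) -> (f z \in B').
  move=> zB; have [zA|zA] := boolP (z \in A).
    exact: (subsetP AB') (fA _ zA).
  have : index z (t A B) < size (enum A' ++ enum (B' :\: A')).
    rewrite /t catA index_cat ifT; last by rewrite mem_cat !mem_enum !inE zA zB orbT.
    rewrite size_cat -szA -szD -size_cat.
    by rewrite index_mem mem_cat !mem_enum !inE zA zB orbT.
  move=> h; rewrite /f /t catA nth_cat h.
  have := mem_nth z h; rewrite mem_cat !mem_enum !inE.
  by case/orP => [/(subsetP AB')|/andP[]].
exists (perm finj); split; apply/eqP; rewrite eqEcard; apply/andP; split.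
- by apply/subsetP => _ /imsetP[z zA ->]; rewrite permE fA.
- by rewrite card_imset ?cA //; apply: perm_inj.
- by apply/subsetP => _ /imsetP[z zA ->]; rewrite permE fB.
- by rewrite card_imset ?cB //; apply: perm_inj.
Qed.

Lemma flagM n (s p : 'S_n) k : flag (s * p)%g k = p @: flag s k.
Proof. by rewrite /flag -imset_comp; apply: eq_imset => i /=; rewrite permM. Qed.

Lemma card_through2_perm n (p : 'S_n) (A B : {set 'I_n}) :
  #|through (p @: A) :&: through (p @: B)| = #|through A :&: through B|.
Proof.
rewrite -[RHS](card_imset _ (@mulIg _ p)); apply: eq_card => s.
rewrite !(inE, in_through) !card_imset; try exact: perm_inj.
have pI := imset_inj (@perm_inj _ p).
apply/idP/imsetP => [|[r + ->]].
  move=> h; exists (s * p^-1)%g; last by rewrite mulgKV.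
  by rewrite inE !in_through -(inj_eq pI) -[X in _ && X](inj_eq pI) -!flagM mulgKV.
by rewrite !(inE, in_through) !flagM !(inj_eq pI).
Qed.

Lemma card_through_orbit n (A B : {set 'I_n}) (S : {set {set 'I_n}}) :
    {in S, forall C : {set 'I_n}, #|C| = #|B| /\
      exists p : 'S_n, p @: A = A /\ p @: B = C} ->
    {in through A, forall s, flag s #|B| \in S} ->
  #|through A :&: through B| * #|S| = #|through A|.
Proof.
move=> hS hf; rewrite -[RHS]sum1_card (partition_big (fun s => flag s #|B|) _ hf).
rewrite mulnC -sum_nat_const; apply/esym/eq_bigr => C CS /=.
have [cC [p [pA pB]]] := hS _ CS.
rewrite sum1_card -(card_through2_perm p) pA pB.
by apply: eq_card => s; rewrite in_setI unfold_in !in_through cC.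
Qed.

Lemma set_card_le_n n (A : {set 'I_n}) : #|A| <= n.
Proof. by rewrite -[X in _ <= X]card_ord max_card. Qed.

Lemma card_through_down n (A B : {set 'I_n}) : A \subset B ->
  #|through A :&: through B| * 'C(#|B|, #|A|) = #|through B|.
Proof.
move=> AB; rewrite -cards_draws setIC.
apply: card_through_orbit => [C|s].
  rewrite inE => /andP[CB /eqP cC]; split=> //.
  by have [p [pA pB]] := set_perm_trans AB CB (esym cC) erefl; exists p.
rewrite in_through inE => /eqP sB; rewrite -{1}sB flagS ?card_flag ?set_card_le_n ?eqxx //.
exact: subset_leq_card.
Qed.

Lemma card_supersets (T : finType) (A : {set T}) k : #|A| <= k -> k <= #|T| ->
  #|[set C : {set T} | A \subset C & #|C| == k]| = 'C(#|T| - #|A|, k - #|A|).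
Proof.
move=> Ak kT; rewrite -cardsT -cardsDS ?subsetT // setTD.
have -> : 'C(#|~: A|, k - #|A|) = 'C(#|~: A|, #|T| - k).
  rewrite -[LHS]bin_sub; last by have := cardsC A; lia.
  by congr 'C(_, _); have := cardsC A; lia.
rewrite -cards_draws -[RHS](card_imset _ (inv_inj (@setCK T))).
apply: eq_card => C; rewrite inE; apply/idP/imsetP => [/andP[AC /eqP cC]|[D + ->]].
  exists (~: C); rewrite ?setCK // inE setCS AC /=; apply/eqP.
  by rewrite -(cardsC C) cC addKn.
rewrite inE subsetC => /andP[-> /eqP cD] /=.
by rewrite -(eqn_add2l #|D|) cardsC cD subnK.
Qed.

Lemma card_through_up n (A B : {set 'I_n}) : A \subset B ->
  #|through A :&: through B| * 'C(n - #|A|, #|B| - #|A|) = #|through A|.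
Proof.
move=> AB; have cAB := subset_leq_card AB.
rewrite -[X in 'C(X - _, _)]card_ord -card_supersets ?card_ord ?set_card_le_n //.
apply: card_through_orbit => [C|s].
  rewrite inE => /andP[AC /eqP cC]; split=> //.
  by have [p [pA pB]] := set_perm_trans AB AC erefl (esym cC); exists p.
rewrite in_through inE => /eqP sA; rewrite -{1}sA flagS ?card_flag ?set_card_le_n ?eqxx //.
Qed.

Lemma through0 n : through (set0 : {set 'I_n}) = setT.
Proof.
apply/setP => s; rewrite in_through inE cards0; apply/eqP/setP => i.
by rewrite inE; apply/imsetP => -[j]; rewrite inE.
Qed.

Lemma card_through n (A : {set 'I_n}) : #|through A| * 'C(n, #|A|) = n`!.
Proof.
have := card_through_up (sub0set A).
by rewrite through0 setTI cards0 !subn0 cardsT card_Sn.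
Qed.

Lemma middle_bin n m t : n <= 4 * m -> 0 < t < m -> n <= 4 * 'C(m, t).
Proof.
move=> nm /andP[t0 tm]; have : 'C(m, 1) <= 'C(m, t).
  case: (leqP t (m - 1)) => h; last lia.
  by apply: bin_unimodal => //; lia.
by rewrite bin1; lia.
Qed.

Lemma middle_bin2 n m t : n <= 4 * m.-2 ->
  1 < t < m.-1 -> n ^ 2 <= 64 * 'C(m, t).
Proof.
move=> nm /andP[t0 tm]; have : 'C(m, 2) <= 'C(m, t) by apply: bin_unimodal => //; lia.
rewrite bin2 => h.
have e : (m * m.-1)./2.*2 = m * m.-1.
  by case: m {h nm tm} => // m; rewrite even_halfK // oddM /=; case: odd.
suff : n ^ 2 <= 32 * (m * m.-1) by lia.
apply: leq_trans (_ : (4 * m.-2) ^ 2 <= _); first by rewrite leq_sqr.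
by rewrite expnMn -mulnn; nia.
Qed.

Lemma card_through_pair_mid n (A B : {set 'I_n}) : 8 <= n ->
  middle A -> middle B -> A \proper B ->
  n * #|through A :&: through B| <= 4 * minn #|through A| #|through B|.
Proof.
move=> n8 /andP[A1 A2] /andP[B1 B2] AB; have [sAB cAB] := (proper_sub AB, proper_card AB).
have h1 : n <= 4 * 'C(n - #|A|, #|B| - #|A|) by apply: middle_bin => //; lia.
have h2 : n <= 4 * 'C(#|B|, #|A|) by apply: middle_bin => //; lia.
have := card_through_up sAB; have := card_through_down sAB; nia.
Qed.

Lemma card_through_pair_mid2 n (A B : {set 'I_n}) : 8 <= n ->
  middle A -> middle B -> A \subset B -> #|A| + 2 <= #|B| ->
  n ^ 2 * #|through A :&: through B| <= 64 * minn #|through A| #|through B|.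
Proof.
move=> n8 /andP[A1 A2] /andP[B1 B2] sAB cAB.
have h1 : n ^ 2 <= 64 * 'C(n - #|A|, #|B| - #|A|) by apply: middle_bin2 => //; lia.
have h2 : n ^ 2 <= 64 * 'C(#|B|, #|A|) by apply: middle_bin2 => //; lia.
have := card_through_up sAB; have := card_through_down sAB; nia.
Qed.

Lemma lym n (F : {set {set 'I_n}}) :
  #|F| * n`! <= (\sum_(A in F) #|through A|) * 'C(n, n./2).
Proof.
rewrite -sum_nat_const big_distrl leq_sum //= => A _.
rewrite -(card_through A) leq_mul2l; apply/orP; right.
have := set_card_le_n A => cA; case: (leqP #|A| n./2) => hA.
  by apply: bin_unimodal; lia.
by rewrite -bin_sub //; apply: bin_unimodal; lia.
Qed.

Section HasseDistance.
Variables (disp : Order.disp_t) (T : finPOrderType disp) (x : T).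
Hypothesis treeT : tree_poset T.

Let conn : forall u v : T, connect (@hasse_adj _ T) u v := proj1 treeT.

Lemma hasse_adj_sym (u v : T) : hasse_adj u v = hasse_adj v u.
Proof. by rewrite /hasse_adj orbC. Qed.

Lemma within_adj k (u v : T) :
  u \in within x k -> hasse_adj u v -> v \in within x k.+1.
Proof.
by move=> uk uv; rewrite /= !inE; apply/orP; right; apply/existsP; exists u; rewrite uk.
Qed.

Lemma within_path p : path (@hasse_adj _ T) x p -> last x p \in within x (size p).
Proof.
elim/last_ind: p => [|p v IH] /=; first by rewrite inE.
rewrite rcons_path last_rcons size_rcons => /andP[/IH xp pv].
exact: within_adj pv.
Qed.

Lemma within_hasse_dist u : u \in within x (hasse_dist x u).
Proof.
have /connectP[p + ->] := conn x u => /shortenP[p' xp' up' _].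
set v := last x p'; have hs : has (fun k => v \in within x k) (iota 0 #|T|).
  apply/hasP; exists (size p'); last exact: within_path.
  by rewrite mem_iota /= add0n; have := card_uniqP up'; rewrite /= => <-; apply: max_card.
have := nth_find 0 hs; rewrite nth_iota ?add0n; first by [].
by move: hs; rewrite has_find size_iota.
Qed.

Lemma hasse_dist_le u k : u \in within x k -> hasse_dist x u <= k.
Proof.
move=> uk; rewrite leqNgt; apply/negP => lt; have := before_find 0 lt.
rewrite nth_iota ?add0n ?uk //; apply: leq_trans lt _.
by rewrite -[X in _ <= X](size_iota 0) find_size.
Qed.

Lemma hasse_dist_eq0 u : (hasse_dist x u == 0) = (u == x).
Proof.
apply/eqP/eqP => [u0|->]; first by have := within_hasse_dist u; rewrite u0 inE => /eqP.
by apply/eqP; rewrite -leqn0; apply: hasse_dist_le; rewrite inE.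
Qed.

Lemma hasse_distS u k : hasse_dist x u = k.+1 ->
  exists2 v, hasse_dist x v = k & hasse_adj v u.
Proof.
move=> uk; have := within_hasse_dist u; rewrite uk /= !inE => /orP[/hasse_dist_le|].
  by rewrite uk ltnn.
case/existsP => v /andP[vk vu]; exists v => //; apply/eqP; rewrite eqn_leq hasse_dist_le //=.
rewrite -ltnS -uk; apply: hasse_dist_le; apply: within_adj vu; exact: within_hasse_dist.
Qed.

(* Two parents of a vertex at distance 2 would close a 4-cycle through x. *)
Lemma hasse_parent_uniq u v v' : hasse_dist x u <= 2 ->
    hasse_dist x u = (hasse_dist x v).+1 -> hasse_dist x u = (hasse_dist x v').+1 ->
  hasse_adj v u -> hasse_adj v' u -> v = v'.
Proof.
move=> u2 uv uv' vu v'u.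
case dv : (hasse_dist x v) uv => [|[|k]] uv; last by rewrite uv in u2.
  have := hasse_dist_eq0 v; rewrite dv eqxx => /esym/eqP ->.
  by have := hasse_dist_eq0 v'; move: uv'; rewrite uv => -[<-]; rewrite eqxx => /esym/eqP ->.
have dv' : hasse_dist x v' = 1 by move: uv'; rewrite uv => -[].
have adjx w : hasse_dist x w = 1 -> hasse_adj x w.
  by case/hasse_distS => y /eqP; rewrite hasse_dist_eq0 => /eqP ->.
apply/eqP/negPn/negP => vv'; have x0 : hasse_dist x x = 0 by apply/eqP; rewrite hasse_dist_eq0.
have neq a b : hasse_dist x a != hasse_dist x b -> a != b by apply: contraNneq => ->.
have := (proj2 treeT) [:: u; v; x; v'].
rewrite /= !inE !negb_or vv' !neq ?uv ?dv ?dv' ?x0 //= => /(_ isT isT)/negP; apply.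
by rewrite (hasse_adj_sym u) vu (hasse_adj_sym v) !adjx // v'u.
Qed.

End HasseDistance.

Section Rank.
Variables (disp : Order.disp_t) (T : finPOrderType disp).
Local Open Scope order_scope.

Definition rank (v : T) : nat :=
  \max_(C : {set T} | is_chain C && [forall c in C, c < v]) #|C|.

Lemma is_chainU1 (u : T) (C : {set T}) :
  is_chain C -> [forall c in C, c < u] -> is_chain (u |: C).
Proof.
move=> /forall_inP chC /forall_inP ltC.
apply/forall_inP => a; rewrite !inE => aC; apply/forall_inP => b; rewrite !inE => bC.
case/orP: aC => [/eqP->|aC]; case/orP: bC => [/eqP->|bC]; rewrite ?lexx //.
- by rewrite (ltW (ltC b bC)) orbT.
- by rewrite (ltW (ltC a aC)).
by move/forall_inP: (chC a aC); apply.
Qed.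

Lemma rank_witness (u : T) : exists C : {set T},
  [/\ is_chain C, [forall c in C, c < u] & #|u |: C| = (rank u).+1].
Proof.
pose P := [pred C : {set T} | is_chain C && [forall c in C, c < u]].
have P0 : (0 < #|P|)%N.
  by apply/card_gt0P; exists set0; apply/andP; split; apply/forall_inP => a; rewrite inE.
have [C /andP[chC ltC] E] := eq_bigmax_cond (fun C : {set T} => #|C|) P0.
have Er : rank u = #|C| by rewrite -E.
exists C; split=> //; rewrite cardsU1 Er; case: (boolP (u \in C)) => // uC.
by have /forall_inP/(_ u uC) := ltC; rewrite ltxx.
Qed.

Lemma rank_lt (u v : T) : u < v -> (rank u < rank v)%N.
Proof.
move=> uv; have [C [chC ltC <-]] := rank_witness u.
apply: leq_bigmax_cond; rewrite is_chainU1 //=.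
apply/forall_inP => c; rewrite !inE => /orP[/eqP->//|cC].
by apply: lt_trans uv; move/forall_inP: ltC; apply.
Qed.

Lemma rank_height (u : T) : (rank u < height T)%N.
Proof.
have [C [chC ltC <-]] := rank_witness u.
by apply: leq_bigmax_cond; rewrite is_chainU1.
Qed.

End Rank.

Section Blowup.
Variables (disp : Order.disp_t) (T : finPOrderType disp) (x : T) (d : nat).
Hypothesis treeT : tree_poset T.
Hypothesis dist2 : forall u : T, hasse_dist x u <= 2.

Local Notation B := (blowup_type x d).
Implicit Types a b : B.

Definition depth b := hasse_dist x (tag b).

Definition is_parent b a := bu_link b a && hasse_adj (tag a) (tag b).

Definition parent b := odflt b [pick a | is_parent b a].

Lemma blowup_inj a b : tag a = tag b -> tagged a = tagged b :> nat -> a = b.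
Proof.
by case: a b => u i [v j] /= uv; subst v => ij; congr (Tagged _ _); apply: val_inj.
Qed.

Lemma is_parent_uniq b a a' : is_parent b a -> is_parent b a' -> a = a'.
Proof.
move=> /andP[/andP[/eqP da /eqP ia] aa] /andP[/andP[/eqP da' /eqP ia'] aa'].
apply: blowup_inj; last by rewrite -ia -ia'.
exact: (hasse_parent_uniq treeT (dist2 (tag b)) da da' aa aa').
Qed.

Lemma parentP b : 0 < depth b -> is_parent b (parent b).
Proof.
move=> b0; rewrite /parent; case: pickP => //= no.
move: b0; rewrite /depth; case E : (hasse_dist x (tag b)) => [//|k] _.
have [v vk vb] := hasse_distS treeT E.
have hi : tagged b %/ d < d ^ hasse_dist x v.
  have h : tagged b < d ^ k * d by rewrite -expnSr -E ltn_ord.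
  have := leq_ltn_trans (leq0n _) h; rewrite muln_gt0 => /andP[_ d0].
  by rewrite vk ltn_divLR.
have /negP := negbT (no (Tagged (fun u => 'I_(d ^ hasse_dist x u)) (Ordinal hi))).
by case; rewrite /is_parent /bu_link /= vb eqxx !andbT; apply/eqP; rewrite vk.
Qed.

Lemma bu_edge_parent a b : bu_edge a b ->
  (0 < depth b /\ a = parent b) \/ (0 < depth a /\ b = parent a).
Proof.
have adj : covers (tag a) (tag b) -> hasse_adj (tag a) (tag b) by rewrite /hasse_adj => ->.
case/andP => /adj ab /orP[|] l; [right|left]; have /andP[/eqP dl _] := l.
  have a0 : 0 < depth a by rewrite /depth dl.
  by split=> //; apply: is_parent_uniq (parentP a0); rewrite /is_parent l hasse_adj_sym.
have b0 : 0 < depth b by rewrite /depth dl.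
by split=> //; apply: is_parent_uniq (parentP b0); rewrite /is_parent l.
Qed.

Lemma depth_parent b : 0 < depth b -> depth b = (depth (parent b)).+1.
Proof. by move=> /parentP/andP[/andP[/eqP]]. Qed.

Lemma blowup_root : exists root : B, forall b, (depth b == 0) = (b == root).
Proof.
have x0 : hasse_dist x x = 0 by apply/eqP; rewrite hasse_dist_eq0.
have h0 : 0 < d ^ hasse_dist x x by rewrite x0.
exists (Tagged (fun u => 'I_(d ^ hasse_dist x u)) (Ordinal h0)) => b.
apply/idP/eqP => [b0|->]; last by rewrite /depth /= x0.
apply: blowup_inj; first by apply/eqP; rewrite -hasse_dist_eq0.
have := ltn_ord (tagged b); move: b0; rewrite /depth => /eqP.
by case: (tagged b) => i /= hi b0 _; move: hi; rewrite b0 ltnS leqn0 => /eqP.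
Qed.

Lemma card_blowup_sub (S : {set B}) (k : B -> nat) m :
    {in S, forall b, k b < m} ->
    {in S &, forall a b, tag a = tag b -> k a = k b -> tagged a = tagged b :> nat} ->
  #|S| <= #|T| * m.
Proof.
move=> km kinj; case: m km => [|m] km.
  by rewrite muln0 leqn0 cards_eq0 -subset0; apply/subsetP => b /km.
pose f b := (tag b, inord (k b) : 'I_m.+1).
have finj : {in S &, injective f}.
  move=> a b aS bS [ab /(congr1 val)]; rewrite /= !inordK ?km // => kab.
  exact: blowup_inj ab (kinj _ _ aS bS ab kab).
by rewrite -(card_in_imset finj) (leq_trans (max_card _)) // card_prod card_ord.
Qed.

Lemma card_depth k : #|[set b | depth b == k]| <= #|T| * d ^ k.
Proof.
apply: (card_blowup_sub (k := fun b => tagged b)) => // b; rewrite inE => /eqP <-.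
exact: ltn_ord.
Qed.

Lemma card_fiber a : #|[set b | (depth b == 2) && (parent b == a)]| <= #|T| * d.
Proof.
have link b : b \in [set b | (depth b == 2) && (parent b == a)] ->
    0 < depth b /\ tagged b %/ d = tagged a :> nat.
  rewrite inE => /andP[/eqP b2 /eqP <-]; have b0 : 0 < depth b by rewrite b2.
  by split=> //; have /andP[/andP[_ /eqP]] := parentP b0.
apply: (card_blowup_sub (k := fun b => tagged b %% d)).
  move=> b /link[b0 _]; rewrite ltn_mod.
  have := leq_ltn_trans (leq0n _) (ltn_ord (tagged b)); rewrite -/(depth b).
  by rewrite -(prednK b0) expnS muln_gt0 => /andP[].
move=> b c /link[_ Eb] /link[_ Ec] _ E.
by rewrite (divn_eq (tagged b) d) (divn_eq (tagged c) d) Eb Ec E.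
Qed.

End Blowup.

Definition side h n (i j : 'I_h) (A B : {set 'I_n}) :=
  if (i < j)%N then A \proper B else B \proper A.

Lemma leq_card_bigcup (I T : finType) (P : pred I) (S : I -> {set T}) :
  #|\bigcup_(i | P i) S i| <= \sum_(i | P i) #|S i|.
Proof.
elim/big_rec2: _ => [|i m A _ IH]; first by rewrite cards0.
by apply: leq_trans (leq_card_setU _ _) _; rewrite leq_add2l.
Qed.

Section Flip.
Variable n : nat.
Implicit Types A B : {set 'I_n}.

Definition flip A i : {set 'I_n} := [set k | (k \in A) (+) (k == i)].

Definition nbr A : {set {set 'I_n}} := [set flip A i | i : 'I_n].

Lemma card_nbr A : #|nbr A| <= n.
Proof. by rewrite -[X in _ <= X]card_ord leq_imset_card. Qed.

Lemma flipK A i : flip (flip A i) i = A.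
Proof. by apply/setP => k; rewrite !inE addbK. Qed.

Lemma card_common_nbr A B : A != B -> #|nbr A :&: nbr B| <= 2.
Proof.
move=> AB; case: (set_0Vmem (nbr A :&: nbr B)) => [->|[C0]]; first by rewrite cards0.
rewrite inE => /andP[/imsetP[i0 _ ->] /imsetP[j0 _ E0]].
have {}E0 : B = flip (flip A i0) j0 by rewrite E0 flipK.
apply: leq_trans (_ : #|[set flip A i0; flip A j0]| <= 2); last first.
  by rewrite cards2; case: (_ != _).
apply/subset_leq_card/subsetP => C; rewrite inE => /andP[/imsetP[i _ ->] /imsetP[j _ E]].
have {}E : B = flip (flip A i) j by rewrite E flipK.
have ij : i != j by apply: contraNneq AB => ij; rewrite E ij flipK.
have /setP/(_ i) : flip (flip A i) j = flip (flip A i0) j0 by rewrite -E.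
rewrite !inE eqxx (negPf ij) addbF -addbA => /addbI.
case: (eqVneq i i0) => [->|_] /=; first by rewrite eqxx.
by case: (eqVneq i j0) => [->|] //=; rewrite eqxx orbT.
Qed.

Lemma proper_not_nbr A B : A \proper B -> B \notin nbr A -> #|A| + 2 <= #|B|.
Proof.
move=> AB nB; have := proper_card AB; rewrite leq_eqVlt => /orP[/eqP cAB|]; last lia.
have /eqP/cards1P[i Di] : #|B :\: A| = 1 by rewrite cardsDS ?proper_sub // -cAB subSnn.
case/negP: nB; apply/imsetP; exists i => //; apply/setP => k.
have := proper_sub AB => /subsetP/(_ k); move/setP/(_ k): Di; rewrite !inE.
by do 2!case: (k \in _) => //=; case: eqP => // _ _ /(_ isT).
Qed.

Lemma nbr_sym A B : (A \in nbr B) = (B \in nbr A).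
Proof.
by apply/imsetP/imsetP => -[i _ ->]; exists i; rewrite ?flipK.
Qed.

End Flip.

Lemma side_through_pair n h (i j : 'I_h) (A B : {set 'I_n}) : 8 <= n ->
    middle A -> middle B -> side i j A B ->
  n ^ 2 * #|through A :&: through B| <=
    (4 * n * (B \in nbr A) + 64) * #|through A|.
Proof.
move=> n8 mA mB sAB; have [BA|BA] := boolP (B \in nbr A); last first.
  rewrite muln0 add0n; move: sAB; rewrite /side; case: ifP => _ sAB.
    have h2 := proper_not_nbr sAB BA.
    have := card_through_pair_mid2 n8 mA mB (proper_sub sAB) h2; lia.
  rewrite nbr_sym in BA; have h2 := proper_not_nbr sAB BA.
  have := card_through_pair_mid2 n8 mB mA (proper_sub sAB) h2; rewrite setIC; lia.
have : n * #|through A :&: through B| <= 4 * #|through A|; last by nia.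
move: sAB; rewrite /side; case: ifP => _ sAB.
  have := card_through_pair_mid n8 mA mB sAB; lia.
have := card_through_pair_mid n8 mB mA sAB; rewrite setIC; lia.
Qed.

Local Open Scope ring_scope.

Lemma cleaning (R : realDomainType) (M V I : finType) (at_ : M -> I -> V)
    (w : V -> R) (L0 : {set M}) :
    (forall v, 0 <= w v) ->
    \sum_(q : I * V | [exists m in L0, at_ m q.1 == q.2]) w q.2 < #|L0|%:R ->
  exists L : {set M}, [/\ L \subset L0, L != set0 &
    forall m i, m \in L ->
      w (at_ m i) <= #|[set m' in L | at_ m' i == at_ m i]|%:R].
Proof.
move=> w0 hL0.
pose seen (L : {set M}) (q : I * V) := [exists m in L, at_ m q.1 == q.2].
pose g (L : {set M}) : R := #|L|%:R - \sum_(q | seen L q) w q.2.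
have [L LL0 Lmax] := @arg_maxP _ _ {set M} L0 (fun L => L \subset L0) g (subxx L0).
have gL : 0 < g L by apply: lt_le_trans (Lmax _ (subxx _)); rewrite subr_gt0.
exists L; split=> //.
  apply: contraTneq gL => ->; rewrite -leNgt /g cards0 sub0r oppr_le0.
  by apply: sumr_ge0.
move=> m i mL; rewrite leNgt; apply/negP => bad.
set D := [set m' in L | at_ m' i == at_ m i] in bad *.
have DL : D \subset L by apply/subsetP => m'; rewrite inE => /andP[].
have := Lmax (L :\: D) (subset_trans (subsetDl _ _) LL0); apply/negP; rewrite -ltNge.
rewrite /g cardsDS // natrB ?subset_leq_card //.
have seenL : seen L (i, at_ m i) by apply/existsP; exists m; rewrite mL eqxx.
rewrite [X in _ - X < _](bigD1 _ seenL) /=.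
suff h : \sum_(q | seen (L :\: D) q) w q.2 <=
    \sum_(q | seen L q && (q != (i, at_ m i))) w q.2 by lra.
rewrite [leRHS](bigID (seen (L :\: D))) /= -[leLHS]addr0 lerD ?sumr_ge0 //.
rewrite le_eqVlt; apply/orP; left; apply/eqP/eq_bigl => q.
rewrite andbC; case: (boolP (seen _ q)) => //= /existsP[m' /andP[]].
rewrite in_setD => /andP[m'D m'L] /eqP Eq; symmetry; apply/andP; split.
  by apply/existsP; exists m'; rewrite m'L /=; apply/eqP.
by apply: contraNneq m'D => Eq'; rewrite inE m'L; move: Eq; rewrite Eq' /= => ->.
Qed.

Section Marked.
Variables (n : nat) (F : {set {set 'I_n}}).
Local Open Scope nat_scope.

Definition levels (s : 'S_n) : seq nat := [seq k <- iota 0 n.+1 | flag s k \in F].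

Definition member (s : 'S_n) (m : nat) : {set 'I_n} := flag s (nth 0 (levels s) m).

Lemma levels_le s m : nth 0 (levels s) m <= n.
Proof.
case: (ltnP m (size (levels s))) => [/(mem_nth 0)|/(nth_default _) -> //].
by rewrite mem_filter mem_iota ltnS => /andP[_ /andP[]].
Qed.

Lemma member_in s m : m < size (levels s) -> member s m \in F.
Proof. by move=> /(mem_nth 0); rewrite mem_filter => /andP[]. Qed.

Lemma member_through s m : s \in through (member s m).
Proof. by rewrite in_through card_flag ?levels_le. Qed.

Lemma member_proper s m m' :
  m < m' -> m' < size (levels s) -> member s m \proper member s m'.
Proof.
move=> mm' m's; apply: flag_proper (levels_le _ _) _.
have srt : sorted ltn (levels s) by apply/sorted_filter/iota_ltn_sorted; exact: ltn_trans.
by rewrite (sorted_ltn_nth ltn_trans) // inE (ltn_trans mm').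
Qed.

Lemma member_inj s : {in gtn (size (levels s)) &, injective (member s)}.
Proof.
move=> m m' ms m's E; case: (ltngtP m m') => // lt.
  by have := member_proper lt m's; rewrite E properxx.
by have := member_proper lt ms; rewrite E properxx.
Qed.

Lemma size_levels s : size (levels s) <= n.+1.
Proof. by rewrite size_filter -[X in _ <= X](size_iota 0) count_size. Qed.

Lemma sum_through_levels :
  \sum_(A in F) #|through A| <= \sum_s size (levels s).
Proof.
under eq_bigr do rewrite -sum1_card big_mkcond.
rewrite exchange_big leq_sum // => s _.
rewrite -big_mkcondr sum1_card -(size_map (flag s)).
apply: leq_trans (card_size _); apply/subset_leq_card/subsetP => A.
rewrite unfold_in in_through => /andP[AF /eqP sA]; apply/mapP; exists #|A| => //.
by rewrite mem_filter sA AF mem_iota /= ltnS set_card_le_n.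
Qed.

Definition windows (h : nat) : {set 'S_n * 'I_n.+2} :=
  [set p : 'S_n * 'I_n.+2 | p.2 + h <= size (levels p.1)].

Lemma card_windows h : 0 < h ->
  \sum_(A in F) #|through A| <= #|windows h| + h.-1 * n`!.
Proof.
move=> h0; apply: leq_trans sum_through_levels _.
have -> : #|windows h| = \sum_(s : 'S_n) (size (levels s) - h.-1).
  rewrite -sum1_card (eq_bigl (fun p : 'S_n * 'I_n.+2 =>
    true && (p.2 < size (levels p.1) - h.-1))); last first.
    by move=> p; rewrite inE /=; lia.
  rewrite -(pair_big_dep xpredT
    (fun s (k : 'I_n.+2) => k < size (levels s) - h.-1) (fun _ _ => 1)) /=.
  apply: eq_bigr => s _; have := size_levels s => hs.
  rewrite -(big_ord_widen n.+2 (fun=> 1)); last by lia.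
  by rewrite sum1_card card_ord.
rewrite -card_Sn -sum1_card big_distrr -big_split /=.
by apply: leq_sum => s _; lia.
Qed.

End Marked.

Definition robust (R : realFieldType) n h (gam : R) (G : 'I_h -> {set {set 'I_n}}) :=
  forall (i j : 'I_h) A, i != j -> A \in G i ->
    gam * #|through A|%:R <=
    #|[set s in through A | [exists B in G j, side i j A B && (s \in through B)]]|%:R.

Lemma robust_families (R : realFieldType) n h (F : {set {set 'I_n}}) (gam : R) :
    0 <= gam -> (0 < h)%N ->
    (gam * h%:R) * (\sum_(A in F) #|through A|)%:R <
      (\sum_(A in F) #|through A|)%:R - (h%:R - 1) * (n`!)%:R ->
  exists G : 'I_h -> {set {set 'I_n}},
    [/\ forall i, G i \subset F, forall i, G i != set0 & robust gam G].
Proof.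
move=> gam0 h0 hW.
pose at_ (p : 'S_n * 'I_n.+2) (i : 'I_h) := member F p.1 (p.2 + i).
have atF p (i : 'I_h) : p \in windows F h -> (p.2 + i < size (levels F p.1))%N.
  by rewrite inE => hp; apply: (leq_trans _ hp); rewrite -addnS leq_add2l.
have [||L [LW L0 Lrob]] := @cleaning R _ _ _ at_ (fun A => gam * #|through A|%:R) (windows F h).
- by move=> A; rewrite mulr_ge0 ?ler0n.
- have hc : ((\sum_(A in F) #|through A|)%:R : R) <=
      #|windows F h|%:R + (h%:R - 1) * (n`!)%:R.
    have -> : (h%:R - 1 : R) = h.-1%:R by rewrite -[in LHS](prednK h0) -natr1 addrK.
    by rewrite -natrM -natrD ler_nat card_windows.
  apply: le_lt_trans (lt_le_trans hW _); last by lra.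
  rewrite natr_sum mulr_sumr.
  have -> : \sum_(A in F) gam * h%:R * #|through A|%:R =
      \sum_(q : 'I_h * {set 'I_n} | q.2 \in F) gam * #|through q.2|%:R.
    rewrite -(pair_big xpredT (mem F) (fun _ A => gam * #|through A|%:R)) /=.
    rewrite sumr_const card_ord -[RHS]mulr_natl mulr_sumr.
    by apply: eq_bigr => A _; ring.
  rewrite [leRHS](bigID (fun q => [exists m in windows F h, at_ m q.1 == q.2])) /=.
  rewrite -[leLHS]addr0 lerD ?sumr_ge0 // => [|q _]; last by rewrite mulr_ge0.
  rewrite le_eqVlt; apply/orP; left; apply/eqP/eq_bigl => q.
  rewrite andbC; case: (boolP [exists m in _, _]) => //= /existsP[m /andP[mW /eqP <-]].
  by rewrite member_in // atF.
exists (fun i => [set at_ p i | p in L]); split.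
- move=> i; apply/subsetP => _ /imsetP[p pL ->].
  by rewrite member_in // atF // (subsetP LW).
- move=> i; have /set0Pn[p pL] := L0; apply/set0Pn; exists (at_ p i).
  exact: imset_f.
move=> i j _ ij /imsetP[p pL ->]; apply: le_trans (Lrob p i pL) _.
rewrite ler_nat.
set D := [set _ in L | _].
have Dinj : {in D &, injective (fun q : 'S_n * 'I_n.+2 => q.1)}.
  move=> [s k] [s' k']; rewrite !inE /= => /andP[qL /eqP Eq] /andP[q'L /eqP Eq'] E.
  subst s'; congr (_, _); move: Eq; rewrite -Eq' /at_ /=.
  have h1 := atF _ i (subsetP LW _ qL); have h2 := atF _ i (subsetP LW _ q'L).
  by move=> /(member_inj h1 h2)/addIn/val_inj.
rewrite -(card_in_imset Dinj); apply/subset_leq_card/subsetP => _ /imsetP[q + ->].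
rewrite !inE => /andP[qL /eqP Eq]; rewrite -Eq -in_through member_through /=.
apply/existsP; exists (at_ q j); rewrite member_through andbT.
apply/andP; split; first by apply/imsetP; exists q.
rewrite /side; have qW := subsetP LW _ qL.
case: ltngtP (ij) => [ltij|ltji|/val_inj->]; last by rewrite eqxx.
  by rewrite member_proper ?ltn_add2l // atF.
by rewrite member_proper ?ltn_add2l // atF.
Qed.

Lemma robust_extension (R : realFieldType) n h (gam : R) (G : 'I_h -> {set {set 'I_n}})
    (i j : 'I_h) (A : {set 'I_n}) (Q : {set {set 'I_n}}) :
    (8 <= n)%N -> robust gam G -> (forall i, {in G i, forall B, middle B}) ->
    i != j -> A \in G i ->
    (4 * n * #|Q :&: nbr A| + 64 * #|Q|)%:R < gam * (n ^ 2)%:R ->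
  exists B, [/\ B \in G j, B \notin Q & side i j A B].
Proof.
move=> n8 rG mG ij AG hQ.
case: (boolP [exists B in G j, (B \notin Q) && side i j A B]) => [|no].
  by case/existsP => B /and3P[? ? ?]; exists B.
have inQ B : B \in G j -> side i j A B -> B \in Q.
  move=> BG sAB; apply: contraNT no => BQ; apply/existsP; exists B.
  by rewrite BG BQ.
pose S := [set B in Q | middle B && side i j A B].
have h1 : (#|[set s in through A | [exists B in G j, side i j A B && (s \in through B)]]|
    <= \sum_(B in S) #|through A :&: through B|)%N.
  apply: leq_trans (leq_card_bigcup _ _); apply/subset_leq_card/subsetP => s.
  rewrite 2!inE => /andP[sA /existsP[B /and3P[BG sAB sB]]].
  apply/bigcupP; exists B; last by rewrite in_setI sB andbT inE.
  by rewrite inE inQ // (mG j) // sAB.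
have h2 : (n ^ 2 * \sum_(B in S) #|through A :&: through B| <=
    (4 * n * #|Q :&: nbr A| + 64 * #|Q|) * #|through A|)%N.
  have -> : #|Q :&: nbr A| = (\sum_(B in Q) (B \in nbr A))%N.
    by rewrite -sum1_card big_mkcond [RHS]big_mkcond; apply: eq_bigr => B _;
      rewrite inE; do 2!case: (B \in _).
  rewrite -[#|Q|]sum1_card !big_distrr -big_split big_distrl /=.
  rewrite [leqRHS](bigID (mem S)) /=; apply: leq_trans (leq_addr _ _).
  rewrite (eq_bigl (fun B => (B \in Q) && (B \in S))); last first.
    by move=> B; rewrite inE; case: (B \in Q).
  apply: leq_sum => B /andP[_]; rewrite inE => /and3P[_ mB sAB].
  by rewrite muln1; apply: side_through_pair sAB => //; apply: mG AG.
have N0 : (0 < #|through A|)%N.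
  by have := fact_gt0 n; rewrite -(card_through A) muln_gt0 => /andP[].
have h3 := rG i j A ij AG.
suff : (n ^ 2)%:R * (gam * #|through A|%:R) <
    (n ^ 2)%:R * (gam * #|through A|%:R) :> R by rewrite ltxx.
apply: le_lt_trans (_ : (4 * n * #|Q :&: nbr A| + 64 * #|Q|)%:R * #|through A|%:R < _).
  apply: le_trans (ler_wpM2l (ler0n _ _) h3) _; rewrite -!natrM ler_nat.
  by apply: leq_trans h2; rewrite leq_mul2l h1 orbT.
by rewrite mulrA ltr_pM2r ?ltr0n // [ltRHS]mulrC.
Qed.

Lemma greedy (I : finType) (V : eqType) (v0 : V) (ok : I -> V -> Prop) (P : {set I}) :
    (forall (i : I) (D : {set I}) (g : I -> V), i \in P -> D \subset P ->
      {in D, forall j, ok j (g j)} ->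
      exists v, ok i v /\ {in D, forall j, g j != v}) ->
  exists g : I -> V, {in P, forall i, ok i (g i)} /\ {in P &, injective g}.
Proof.
move=> step.
suff H m (D : {set I}) : #|D| = m -> D \subset P -> exists g : I -> V,
  {in D, forall i, ok i (g i)} /\ {in D &, injective g} by exact: (H _ _ erefl).
elim: m D => [|m IH] D.
  by move=> /eqP; rewrite cards_eq0 => /eqP -> _; exists (fun=> v0); split=> i; rewrite inE.
move=> cD DP; have [i iD] : exists i, i \in D by apply/card_gt0P; rewrite cD.
have D'P : D :\ i \subset P := subset_trans (subD1set _ _) DP.
have [|g [gok ginj]] := IH (D :\ i) _ D'P.
  by have := cardsD1 i D; rewrite iD cD => -[].
have [v [vok vfresh]] := step i (D :\ i) g (subsetP DP _ iD) D'P gok.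
exists (fun j => if j == i then v else g j); split=> [j jD|j k jD kD].
  by case: eqVneq => [->//|ji]; apply: gok; rewrite !inE ji.
case: (eqVneq j i) => [->|ji]; case: (eqVneq k i) => [-> //|ki].
- by move=> E; have := vfresh k; rewrite !inE ki kD E eqxx => /(_ isT).
- by move=> E; have := vfresh j; rewrite !inE ji jD E eqxx => /(_ isT).
by move=> E; apply: ginj; rewrite // !inE ?ji ?ki.
Qed.

Lemma side_neq n h (i j : 'I_h) (A B : {set 'I_n}) : side i j A B -> A != B.
Proof. by rewrite /side; case: ifP => _; apply: contraTneq => ->; rewrite properxx. Qed.

Section Embedding.
Variables (R : realFieldType) (n h : nat) (gam : R) (G : 'I_h -> {set {set 'I_n}}).
Hypotheses (n8 : (8 <= n)%N) (rG : robust gam G).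
Hypothesis mG : forall i, {in G i, forall B, middle B}.
Variables (B : finType) (dep : B -> nat) (par : B -> B) (lab : B -> 'I_h) (root : B).
Hypothesis dep2 : forall b, (dep b <= 2)%N.
Hypothesis dep_root : forall b, (dep b == 0%N) = (b == root).
Hypothesis dep_par : forall b, (0 < dep b)%N -> dep b = (dep (par b)).+1.
Hypothesis lab_par : forall b, (0 < dep b)%N -> lab (par b) != lab b.
Variables (D D2 : nat).
Hypothesis D_dep1 : (#|[set b | dep b == 1%N]| <= D)%N.
Hypothesis D_fiber : forall a, (#|[set b | (dep b == 2) && (par b == a)]| <= D)%N.
Hypothesis D2_dep2 : (#|[set b | dep b == 2]| <= D2)%N.
Hypothesis room :
  (4 * n * (1 + 4 * D) + 64 * (1 + D + D * n + D2))%:R < gam * (n ^ 2)%:R.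

Let B1 : {set B} := [set b | dep b == 1%N].
Let B2 : {set B} := [set b | dep b == 2].

Lemma par_dep1 b : b \in B1 -> par b = root.
Proof.
rewrite inE => /eqP b1; apply/eqP; rewrite -dep_root.
by have := dep_par (b := b); rewrite b1 => /(_ isT) [<-].
Qed.

Lemma par_dep2 b : b \in B2 -> par b \in B1.
Proof.
rewrite !inE => /eqP b2.
by have := dep_par (b := b); rewrite b2 => /(_ isT) [<-].
Qed.

Lemma lab_par1 b : b \in B1 -> lab root != lab b.
Proof.
by move=> bP; rewrite -(par_dep1 bP) lab_par //; move: bP; rewrite inE => /eqP ->.
Qed.

Lemma lab_par2 b : b \in B2 -> lab (par b) != lab b.
Proof. by rewrite inE => /eqP bP; rewrite lab_par // bP. Qed.

Lemma embed_dep1 (A0 : {set 'I_n}) : A0 \in G (lab root) ->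
  exists y : B -> {set 'I_n},
    {in B1, forall b, y b \in G (lab b) /\ side (lab root) (lab b) A0 (y b)} /\
    {in B1 &, injective y}.
Proof.
move=> A0G; pose ok b (C : {set 'I_n}) := C \in G (lab b) /\ side (lab root) (lab b) A0 C.
apply: (greedy set0 (ok := ok)) => b E g bP EP gok.
have cQ : (#|g @: E| <= D)%N.
  by apply: leq_trans (leq_imset_card _ _) (leq_trans (subset_leq_card EP) _).
have [||C [CG CQ sC]] := @robust_extension R n h gam G _ _ A0 (g @: E) n8 rG mG (lab_par1 bP).
- exact: A0G.
- apply: le_lt_trans room; rewrite ler_nat.
  have cQn : (#|g @: E :&: nbr A0| <= D)%N.
    by apply: leq_trans cQ; apply/subset_leq_card/subsetIl.
  by apply: leq_add; rewrite leq_mul2l; apply/orP; right;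
    [apply: leq_trans cQn _ | apply: leq_trans cQ _]; nia.
exists C; split=> // j jE; apply: contraNneq CQ => <-; exact: imset_f.
Qed.

Lemma embed_dep2 (A0 : {set 'I_n}) (y : B -> {set 'I_n}) :
    {in B1, forall b, y b \in G (lab b)} -> {in B1 &, injective y} ->
  exists z : B -> {set 'I_n},
    {in B2, forall b, [/\ z b \in G (lab b), side (lab (par b)) (lab b) (y (par b)) (z b),
        z b != A0 & z b \notin y @: B1]} /\
    {in B2 &, injective z}.
Proof.
move=> yG yinj.
pose others b := \bigcup_(b' in B1 | b' != par b) nbr (y b').
pose ok b (C : {set 'I_n}) := [/\ C \in G (lab b),
  side (lab (par b)) (lab b) (y (par b)) C, C != A0, C \notin y @: B1 & C \notin others b].
suff [z [zok zinj]] : exists z : B -> {set 'I_n},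
    {in B2, forall b, ok b (z b)} /\ {in B2 &, injective z}.
  by exists z; split=> // b /zok[].
apply: (greedy set0) => b E g bP EP gok.
have pbP := par_dep2 bP.
have cY : (#|y @: B1| <= D)%N by apply: leq_trans (leq_imset_card _ _) _.
have cO : (#|others b| <= D * n)%N.
  apply: leq_trans (leq_card_bigcup _ _) _.
  apply: leq_trans (_ : \sum_(b' in B1) n <= _)%N; last first.
    by rewrite sum_nat_const leq_mul2r D_dep1 orbT.
  rewrite [leqRHS](bigID (fun b' => b' != par b)) /=; apply: leq_trans (leq_addr _ _).
  by apply: leq_sum => b' _; apply: card_nbr.
have cE : (#|g @: E| <= D2)%N.
  by apply: leq_trans (leq_imset_card _ _) (leq_trans (subset_leq_card EP) _).
have cOn : (#|others b :&: nbr (y (par b))| <= 2 * D)%N.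
  rewrite /others big_distrl /=; apply: leq_trans (leq_card_bigcup _ _) _.
  apply: leq_trans (_ : \sum_(b' in B1) 2 <= _)%N; last first.
    by rewrite sum_nat_const mulnC leq_mul2l D_dep1.
  rewrite [leqRHS](bigID (fun b' => b' != par b)) /=; apply: leq_trans (leq_addr _ _).
  apply: leq_sum => b' /andP[b'P b'b]; apply: card_common_nbr.
  by apply: contraNneq b'b => /yinj ->.
have cEn : (#|g @: E :&: nbr (y (par b))| <= D)%N.
  apply: leq_trans (D_fiber (par b)); apply: leq_trans (leq_imset_card g _).
  apply/subset_leq_card/subsetP => C; rewrite inE => /andP[/imsetP[j jE ->] gN].
  apply: imset_f; have jP := subsetP EP _ jE; move: (jP); rewrite !inE => -> /=.
  have [_ _ _ _] := gok j jE; apply: contraNeq => jb.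
  by apply/bigcupP; exists (par b) => //; rewrite pbP; apply: contraNneq jb => ->; rewrite eqxx.
pose Q := A0 |: (y @: B1 :|: (others b :|: g @: E)).
have cQ : (#|Q| <= 1 + D + D * n + D2)%N.
  apply: leq_trans (leq_card_setU _ _) _; rewrite cards1 -!addnA leq_add2l.
  apply: leq_trans (leq_card_setU _ _) _; rewrite leq_add //.
  by apply: leq_trans (leq_card_setU _ _) _; rewrite leq_add.
have cQn : (#|Q :&: nbr (y (par b))| <= 1 + 4 * D)%N.
  rewrite /Q !setIUl.
  apply: leq_trans (leq_card_setU _ _) _.
  apply: leq_trans (leq_add (leqnn _) (leq_card_setU _ _)) _.
  apply: leq_trans (leq_add (leqnn _) (leq_add (leqnn _) (leq_card_setU _ _))) _.
  have h1 : (#|[set A0] :&: nbr (y (par b))| <= 1)%N.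
    by rewrite -[X in (_ <= X)%N](cards1 A0) subset_leq_card ?subsetIl.
  have h2 : (#|y @: B1 :&: nbr (y (par b))| <= D)%N.
    by apply: leq_trans cY; rewrite subset_leq_card ?subsetIl.
  by apply: leq_trans (leq_add h1 (leq_add h2 (leq_add cOn cEn))) _; lia.
have [||C [CG CQ sC]] :=
    @robust_extension R n h gam G _ _ (y (par b)) Q n8 rG mG (lab_par2 bP).
- exact: yG.
- by apply: le_lt_trans room; rewrite ler_nat leq_add // leq_mul.
move: CQ; rewrite !in_setU !negb_or in_set1 => /and4P[C1 C2 C3 C4].
exists C; split=> // j jE; apply: contraNneq C4 => <-; exact: imset_f.
Qed.

Lemma embed_depth2 : G (lab root) != set0 ->
  exists f : B -> {set 'I_n}, [/\ injective f, forall b, f b \in G (lab b) &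
    forall b, (0 < dep b)%N -> side (lab (par b)) (lab b) (f (par b)) (f b)].
Proof.
case/set0Pn=> A0 A0G; have [y [yok yinj]] := embed_dep1 A0G.
have yG : {in B1, forall b, y b \in G (lab b)} by move=> b /yok[].
have [z [zok zinj]] := embed_dep2 A0 yG yinj.
pose f b := if dep b == 0%N then A0 else if dep b == 1%N then y b else z b.
have depP b : [\/ b = root, b \in B1 | b \in B2].
  have := dep2 b; case E : (dep b) => [|[|[|//]]] _.
  - by apply: Or31; apply/eqP; rewrite -dep_root E.
  - by apply: Or32; rewrite inE E.
  by apply: Or33; rewrite inE E.
have f0 : f root = A0 by rewrite /f dep_root eqxx.
have f1 b : b \in B1 -> f b = y b by rewrite inE /f => /eqP ->.
have f2 b : b \in B2 -> f b = z b by rewrite inE /f => /eqP ->.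
exists f; split.
- have y0 b : b \in B1 -> y b != A0.
    by case/yok => _ /side_neq; rewrite eq_sym.
  have z0 b : b \in B2 -> z b != A0 by case/zok.
  have yz b b' : b \in B1 -> b' \in B2 -> y b != z b'.
    by move=> bP /zok[_ _ _]; apply: contraNneq => <-; apply: imset_f.
  move=> a b; case: (depP a) => [->|aP|aP]; case: (depP b) => [->|bP|bP] //;
    rewrite ?f0 ?(f1 _ aP) ?(f1 _ bP) ?(f2 _ aP) ?(f2 _ bP).
  + by move=> E; have := y0 _ bP; rewrite -E eqxx.
  + by move=> E; have := z0 _ bP; rewrite -E eqxx.
  + by move=> E; have := y0 _ aP; rewrite E eqxx.
  + exact: yinj.
  + by move=> E; have := yz _ _ aP bP; rewrite E eqxx.
  + by move=> E; have := z0 _ aP; rewrite E eqxx.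
  + by move=> E; have := yz _ _ bP aP; rewrite E eqxx.
  exact: zinj.
- move=> b; case: (depP b) => [->|bP|bP]; first by rewrite f0.
    by rewrite f1 //; have [] := yok b bP.
  by rewrite f2 //; have [] := zok b bP.
move=> b; case: (depP b) => [->|bP|bP] b0.
- by move: b0; rewrite lt0n dep_root eqxx.
- by rewrite (par_dep1 bP) f0 (f1 _ bP); have [] := yok b bP.
by rewrite (f2 _ bP) (f1 _ (par_dep2 bP)); have [] := zok b bP.
Qed.

End Embedding.

Lemma contains_blowup (R : realFieldType) (disp : Order.disp_t)
    (T : finPOrderType disp) (x : T) (d n : nat) (gam : R) (F : {set {set 'I_n}})
    (G : 'I_(height T) -> {set {set 'I_n}}) :
    tree_poset T -> (forall u : T, hasse_dist x u <= 2)%N -> (8 <= n)%N ->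
    (forall i, G i \subset F) -> {in F, forall A, middle A} ->
    (forall i, G i != set0) -> robust gam G ->
    (let D := #|T| * d in
     4 * n * (1 + 4 * D) + 64 * (1 + D + D * n + D * d))%:R < gam * (n ^ 2)%:R ->
  contains_copy F (blowup_le x d).
Proof.
move=> treeT dist2 n8 GF midF G0 rG room.
pose lab (b : blowup_type x d) := Ordinal (rank_height (tag b)).
have [root depth_root] := blowup_root x d treeT.
have covers_rank (u v : T) : covers u v -> (rank u < rank v)%N.
  by case/andP => /rank_lt.
have [|||||f [finj fG fside]] := @embed_depth2 R n (height T) gam G n8 rG _
    _ (@depth _ T x d) (@parent _ T x d) lab root _ depth_root
    (@depth_parent _ T x d treeT) _ (#|T| * d) (#|T| * d * d) _
    (@card_fiber _ T x d treeT) _ room (G0 _).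
- by move=> i A /(subsetP (GF i))/midF.
- by move=> b; apply: dist2.
- move=> b /(parentP treeT)/andP[_ /orP[]] /covers_rank; rewrite -val_eqE /=;
    by case: ltngtP.
- by have := card_depth x d 1; rewrite expn1.
- by have := card_depth x d 2; rewrite -mulnA.
exists f; split=> // [b|]; first exact: (subsetP (GF _)) (fG b).
have edge a b : bu_edge a b -> f a \subset f b.
  move=> ab; have /andP[/covers_rank lt_ab _] := ab.
  case: (bu_edge_parent treeT dist2 ab) => -[d0 E]; have := fside _ d0; rewrite -E /side /=.
    by rewrite lt_ab => /proper_sub.
  by rewrite ltnNge (ltnW lt_ab) => /proper_sub.
move=> a b /connectP[p + ->]; elim: p a => [|c p IH] a //= /andP[/edge ac /IH].
exact: subset_trans.
Qed.

Lemma truncn_bound (R : realType) (t n : nat) (gam : R) :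
    (0 < t)%N -> 0 < gam -> gam <= 1 ->
    let delta := gam / (600 * t%:R) in
    delta^-1 <= n%:R ->
    (let D := t * Num.truncn (delta * n%:R) in
     4 * n * (1 + 4 * D) + 64 * (1 + D + D * n + D * Num.truncn (delta * n%:R)))%:R
  < gam * (n ^ 2)%:R.
Proof.
move=> t0 g0 g1 delta nbig.
have tR : 1 <= t%:R :> R by rewrite ler1n.
have d0 : 0 < delta by rewrite divr_gt0 // mulr_gt0 // (lt_le_trans ltr01).
have n0 : 0 < n%:R :> R by apply: lt_le_trans nbig; rewrite invr_gt0.
have dn1 : 1 <= delta * n%:R.
  by rewrite -[leLHS](mulfV (lt0r_neq0 d0)) ler_pM2l.
have dE : 600 * t%:R * delta = gam.
  rewrite /delta mulrC divfK //; apply: lt0r_neq0; lra.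
have : (Num.truncn (delta * n%:R))%:R <= delta * n%:R by rewrite truncn_le; lra.
set k := Num.truncn _; move=> kd.
have k0 : 0 <= k%:R :> R by [].
rewrite !(natrD, natrM, natrX).
set N : R := n%:R in n0 dn1 kd *; set K : R := k%:R in k0 kd *.
set tt : R := t%:R in tR dE *.
have e1 : delta * N <= N by rewrite ler_piMl //; nra.
have h1 : tt * K <= tt * (delta * N) by nra.
have h2 : 1 <= tt * (delta * N) by nra.
set D : R := tt * K in h1 *; set X := tt * (delta * N) in h1 h2 *.
have D0 : 0 <= D by rewrite mulr_ge0 //; lra.
have N1 : 1 <= N by lra.
have h3 : D * K <= X * N by apply: ler_pM => //; lra.
have h4 : D * N <= X * N by apply: ler_wpM2r => //; lra.
have h5 : X <= X * N by rewrite ler_peMr //; lra.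
have h6 : gam * N ^+ 2 = 600 * (X * N) by rewrite -dE /X; ring.
rewrite h6; nra.
Qed.

Lemma card_middle_lower (R : realFieldType) n j (eps a : R) (F : {set {set 'I_n}}) :
    4 <= eps * 2 ^+ j -> (12 * j.+2 <= n)%N ->
    (a + eps) * ('C(n, n./2))%:R <= #|F|%:R ->
  (a + eps / 2) * ('C(n, n./2))%:R <= #|[set A in F | middle A]|%:R.
Proof.
move=> ej nj hF.
have cF : (#|F| <= #|[set A in F | middle A]| + #|[set A : {set 'I_n} | ~~ middle A]|)%N.
  apply: leq_trans (leq_card_setU _ _); apply/subset_leq_card/subsetP => A.
  by rewrite !inE => ->; case: (middle A).
have c2b := card_not_middle nj.
rewrite -(ler_nat R) natrD in cF; rewrite -(ler_nat R) !natrM natrX in c2b.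
set C : R := _%:R in hF c2b *; set c2 : R := #|[set A | ~~ _]|%:R in cF c2b.
have J : 0 < 2 ^+ j :> R by apply: exprn_gt0; lra.
have C0 : 0 <= C by apply: ler0n.
suff : c2 <= eps / 2 * C by lra.
rewrite -(ler_pM2l J); nra.
Qed.

Theorem theorem1p7 (R : realType) (disp : Order.disp_t) (T : finPOrderType disp)
  (x : T) :
  tree_poset T ->
  (forall u : T, (hasse_dist x u <= 2)%N) ->
  forall eps : R, 0 < eps ->
  exists2 delta : R, 0 < delta &
    exists N : nat, forall n : nat, (N <= n)%N ->
      forall F : {set {set 'I_n}},
        ((height T)%:R - 1 + eps) * ('C(n, n./2))%:R <= (#|F|)%:R ->
        contains_copy F (blowup_le x (Num.truncn (delta * n%:R))).
Proof.
move=> treeT dist2 eps eps0.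
have h0 : (0 < height T)%N := leq_ltn_trans (leq0n _) (rank_height x).
have t0 : (0 < #|T|)%N by apply/card_gt0P; exists x.
have h1 : 1 <= (height T)%:R :> R by rewrite ler1n.
set h : R := (height T)%:R in h1 *.
pose e := eps / 2; have e0 : 0 < e by rewrite divr_gt0.
pose gam := e / (2 * h * (h + e)).
have gamE : gam * h * (2 * (h + e)) = e.
  rewrite /gam; field; apply/andP; split; apply: lt0r_neq0; lra.
have gam0 : 0 < gam by rewrite divr_gt0 // !mulr_gt0 //; lra.
have hhe : h + e <= h * (h + e) by rewrite ler_peMl //; lra.
have gam1 : gam <= 1 by rewrite ler_pdivrMr ?mul1r; lra.
pose delta := gam / (600 * #|T|%:R); exists delta.
  by rewrite divr_gt0 // mulr_gt0 // ltr0n.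
pose j := (Num.truncn (4 / eps)).+1.
have ej : 4 <= eps * 2 ^+ j.
  have : 4 / eps < j%:R by rewrite truncnS_gt.
  rewrite ltr_pdivrMr // mulrC => /ltW/le_trans; apply.
  by rewrite ler_pM2l // -natrX ler_nat ltnW // ltn_expl.
exists (maxn (12 * j.+2) (Num.truncn delta^-1).+1) => n.
rewrite geq_max => /andP[nj nd] F hF.
clearbody j; have n8 : (8 <= n)%N by lia.
have n2 : (n./2 <= n)%N by lia.
pose F' := [set A in F | middle A].
have hF' : (h - 1 + e) * ('C(n, n./2))%:R <= #|F'|%:R :=
  card_middle_lower ej nj hF.
pose W : R := (\sum_(A in F') #|through A|)%:R.
have hW : (h - 1 + e) * (n`!)%:R <= W.
  have C0 : 0 < ('C(n, n./2))%:R :> R by rewrite ltr0n bin_gt0.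
  rewrite -(ler_pM2r C0) mulrAC; apply: le_trans (ler_wpM2r (ler0n _ _) hF') _.
  by rewrite -!natrM ler_nat lym.
have f0 : 0 < (n`!)%:R :> R by rewrite ltr0n fact_gt0.
have [|G [GF G0 rG]] := @robust_families R n (height T) F' gam (ltW gam0) h0.
  rewrite -/h -/W; set f : R := (n`!)%:R in hW f0 *; set c := gam * h in gamE *.
  have c1 : 0 <= c by rewrite mulr_ge0 //; lra.
  have c2 : c * (h - 1 + e) <= e / 2 by nra.
  have c3 : c <= 1 / 2 by nra.
  have c4 : (1 - c) * ((h - 1 + e) * f) <= (1 - c) * W by apply: ler_wpM2l => //; lra.
  have c5 : 0 <= (e / 2 - c * (h - 1 + e)) * f by apply: mulr_ge0; lra.
  have c6 : 0 < e * f by apply: mulr_gt0.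
  lra.
have nbig : delta^-1 <= n%:R.
  by apply: ltW; apply: lt_le_trans (truncnS_gt _) _; rewrite ler_nat.
have mid : {in F', forall A, middle A} by move=> A; rewrite inE => /andP[].
have [f [finj fF' fle]] :=
  contains_blowup treeT dist2 n8 GF mid G0 rG (truncn_bound t0 gam0 gam1 nbig).
by exists f; split=> // b; have := fF' b; rewrite inE => /andP[].
Qed.
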